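(* Let $(a_l)_{l\geq1}$ and $(b_l)_{l\geq1}$ be sequences of real numbers and let $n,k,r\geq0$ be integers. Then $$B^{(r)}_{n+r,k+r}(a_1,a_2,\ldots;b_1,b_2,\ldots)=\sum_{\Lambda(n,k,r)}\left[\frac{n!}{k_1!k_2!\cdots}\left(\frac{a_1}{1!}\right)^{k_1}\left(\frac{a_2}{2!}\right)^{k_2}\cdots\right]\left[\frac{r!}{r_0!r_1!\cdots}\left(\frac{b_1}{0!}\right)^{r_0}\left(\frac{b_2}{1!}\right)^{r_1}\cdots\right],$$ where $$\Lambda(n,k,r)=\Big\{\big((k_i)_{i\geq1};(r_i)_{i\geq0}\big): k_i,r_i\in\mathbb{N},\ \sum_{i\geq1}k_i=k,\ \sum_{i\geq0}r_i=r,\ \sum_{i\geq1}i(k_i+r_i)=n\Big\}.$$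
   Context: For sequences $a=(a_l)_{l\geq1}$, $b=(b_l)_{l\geq1}$ and integers $N,K,r\geq0$, the partial $r$-Bell polynomial is $$B^{(r)}_{N,K}(a_1,a_2,\ldots;b_1,b_2,\ldots)=\sum_{\pi}\ \prod_{B\in\pi,\ B\cap\{1,\ldots,r\}=\emptyset}a_{|B|}\prod_{B\in\pi,\ B\cap\{1,\ldots,r\}\neq\emptyset}b_{|B|},$$ where $\pi$ ranges over the partitions of $\{1,\ldots,N\}$ into exactly $K$ nonempty blocks such that $1,\ldots,r$ lie in pairwise distinct blocks (an empty sum is $0$; the empty partition of the empty set contributes $1$). $\mathbb{N}=\{0,1,2,\ldots\}$. *)

(* Defs.v *)
From mathcomp Require Import all_boot all_order all_algebra finmap.
From mathcomp Require Import all_classical all_reals.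
From mathcomp Require Import zify.

Set Implicit Arguments.
Unset Strict Implicit.
Unset Printing Implicit Defensive.

Import GRing.Theory Num.Theory.
Local Open Scope nat_scope.

(* The ground set {1, ..., N} is 'I_N, with i : 'I_N standing for i + 1, so
   that {1, ..., r} is {i | i < r}.  The guard r <= N says that 1, ..., r are
   elements of the ground set: there is no admissible partition otherwise. *)
Definition first_elts (r N : nat) : {set 'I_N} := [set i : 'I_N | i < r].

Definition r_partition (r N K : nat) (P : {set {set 'I_N}}) : bool :=
  [&& r <= N, finset.partition P [set: 'I_N], #|P| == K &
      [forall i in first_elts r N, forall j in first_elts r N,
         (i != j) ==> (finset.pblock P i != finset.pblock P j)]].

(* Sequences indexed by l >= 1 are functions on nat; the value at 0 is never
   used, since blocks of a partition are nonempty. *)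
Definition rBell (R : comPzRingType) (r N K : nat) (a b : nat -> R) : R :=
  (\sum_(P : {set {set 'I_N}} | r_partition r K P)
     (\prod_(B in P | B :&: first_elts r N == finset.set0) a #|B|)
     * (\prod_(B in P | B :&: first_elts r N != finset.set0) b #|B|))%R.

(* A sequence of natural numbers with a finite sum has finite support, so
   Lambda is a set of pairs of finitely supported sequences, and sums and
   products over all indices are sums and products over finsupp.
   A sequence (k_i)_{i >= 1} is encoded with k_0 = 0. *)
Definition finseq := {fsfun nat -> nat with 0}.

Definition Lambda (n k r : nat) : set (finseq * finseq) :=
  [set x : finseq * finseq |
    [/\ x.1 0 = 0,
        \sum_(i <- finsupp x.1) x.1 i = k,
        \sum_(i <- finsupp x.2) x.2 i = r &
        \sum_(i <- (finsupp x.1 `|` finsupp x.2)%fset) i * (x.1 i + x.2 i) = n]]%classic.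

(* Lambda is finite, so that \sum_(x \in Lambda n k r) _ is a genuine sum. *)
Lemma finite_Lambda (n k r : nat) : finite_set (Lambda n k r).
Proof.
pose I := [fset i in iota 0 n.+1]%fset.
pose G (m : nat) (f : {ffun 'I_n.+1 -> 'I_m.+1}) : finseq :=
  [fsfun i in I => f (inord i) : nat | 0].
pose H (f : {ffun 'I_n.+1 -> 'I_k.+1} * {ffun 'I_n.+1 -> 'I_r.+1}) :=
  (G k f.1, G r f.2).
apply: (@sub_finite_set _ _ (H @` setT)%classic); last first.
  exact/finite_image/finite_finset.
have le_sum (s : {fset nat}) (F : nat -> nat) i :
    i \in s -> F i <= \sum_(j <- s) F j.
  by move=> si; rewrite (big_rem i) //= leq_addr.
have GE m (f : finseq) : (forall i, f i != 0 -> i <= n) ->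
    \sum_(i <- finsupp f) f i = m -> G m [ffun i : 'I_n.+1 => inord (f i)] = f.
  move=> fn fm; apply/fsfunP => i; rewrite fsfunE !inE mem_iota.
  have [ltin|lein] := ltnP i n.+1; last first.
    have /eqP -> // : f i == 0 by apply: contraTT lein => /fn; lia.
    by case: ifP => //; case/orP => [/eqP i0|/andP[]//]; rewrite i0 in lein.
  rewrite andbT -leqn0 leqNgt orNb ffunE !inordK // ltnS -fm.
  by case: (finsuppP f i) => [//|fi]; exact: (le_sum _ f).
case=> u v [/= _ uk vr uvn].
have bnd i : (u i != 0) || (v i != 0) -> i <= n.
  move=> uv; have : i * (u i + v i) <= n.
    rewrite -uvn; apply: (le_sum _ (fun i => i * (u i + v i))).
    by rewrite in_fsetU !mem_finsupp.
  by apply: leq_trans; rewrite leq_pmulr //; lia.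
exists ([ffun i : 'I_n.+1 => inord (u i)], [ffun i : 'I_n.+1 => inord (v i)]) => //.
by rewrite /H /= !GE // => i ni; apply: bnd; rewrite ni ?orbT.
Qed.

(* Main.v *)
(** Number the K = k + r blocks of a partition in one of K! ways: a numbered
    partition is a function F from the ground set to 'I_K, the blocks being the
    nonempty fibers of F, and 1, ..., r lie in distinct blocks iff F is injective
    on them.  Split F into its restriction e to {1, ..., r}, which is one of
    K! / k! injections, and an arbitrary function g on the other n points.  A
    label in the image of e has weight b_{l+1}, and any other label weight a_l
    (0 if l = 0), where l is the size of its fiber under g.  Summing over g gives
    the n-th exponential coefficient of A^k B^r, where A = sum_(l >= 1) a_l X^l/l!
    and B = sum_(l >= 0) b_{l+1} X^l/l!.  Hence the Bell polynomial is n!/k! times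
    the coefficient of X^n in A^k B^r, and the multinomial theorem expands it. *)
Require Import Defs.
From mathcomp Require Import all_boot all_order all_algebra finmap.
From mathcomp Require Import all_classical all_reals.
Local Open Scope ring_scope.
Import GRing.Theory Num.Theory.

(** * Exponential generating functions and fiber sizes *)

(** Leibniz's rule, with every summand kept as a product over the whole of [s], so that it has the
    shape of the original product with one factor changed. *)
Lemma deriv_prod_seq (R : comNzRingType) (D : eqType) (F : D -> {poly R})
    (s : seq D) : uniq s ->
  (\prod_(d <- s) F d)^`() =
  \sum_(d <- s) \prod_(c <- s) (if c == d then (F c)^`() else F c).
Proof.
elim: s => [|x s IH] /=; first by rewrite !big_nil derivC.
case/andP=> xs us; rewrite !big_cons derivM IH // eqxx mulr_sumr.
congr (_ * _ + _); apply: eq_big_seq => d ds.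
  by case: eqP ds xs => // -> ->.
by rewrite big_cons; case: eqP ds xs => // <- ->.
Qed.

Lemma card_fiber_ord_recl (D : finType) n (d0 d : D) (f : {ffun 'I_n -> D}) :
  #|[ffun i => oapp f d0 (unlift ord0 i)] @^-1: [set d]| =
  ((d0 == d) + #|f @^-1: [set d]|)%N.
Proof.
rewrite -!sum1_card !(big_mkcond (fun i => i \in _)) big_ord_recl /=.
congr addn; first by rewrite !inE ffunE unlift_none; case: eqP.
by apply: eq_bigr => i _; rewrite !inE ffunE liftK.
Qed.

(* Differentiating the product corresponds to choosing the value of f at ord0,
   which shifts the weight sequence of that value by one. *)
Lemma sum_ffun_fibers (R : numFieldType) (D : finType) n (w : D -> nat -> R)
    (m : D -> nat) : (forall d, (n < m d)%N) ->
  \sum_(f : {ffun 'I_n -> D}) \prod_d w d #|f @^-1: [set d]| =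
  n`!%:R * (\prod_d \poly_(l < m d) (w d l / l`!%:R))`_n.
Proof.
elim: n w m => [|n IH] w m mn.
  rewrite (big_pred1 (ffun0 (card_ord 0))); last first.
    by move=> f /=; apply/esym/eqP/ffunP => -[].
  rewrite coef0_prod mul1r; apply: eq_bigr => d _.
  rewrite coef_poly mn fact0 divr1; congr w.
  by apply/eqP; rewrite cards_eq0; apply/eqP/setP => -[].
have -> : n.+1`!%:R * (\prod_d \poly_(l < m d) (w d l / l`!%:R))`_n.+1 =
   n`!%:R * ((\prod_d \poly_(l < m d) (w d l / l`!%:R))^`())`_n.
  by rewrite coef_deriv factS mulnC mulrnA mulrnAr -mulrnAl.
rewrite deriv_prod_seq ?index_enum_uniq // coef_sum mulr_sumr.
under [RHS]eq_bigr => d _.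
  (* The differentiated factor is one term shorter, so the bound [m] has to vary with the label for
     the induction to go through. *)
  have -> : \prod_c (if c == d
      then (\poly_(l < m c) (w c l / l`!%:R))^`()
      else \poly_(l < m c) (w c l / l`!%:R)) =
    \prod_c \poly_(l < m c - (c == d)) (w c (l + (d == c))%N / l`!%:R).
    apply: eq_bigr => c _; rewrite (eq_sym d).
    case: (c == d); apply/polyP => i; rewrite ?coef_deriv !coef_poly; last first.
      by rewrite subn0 addn0.
    rewrite ltn_subRL add1n.
    case: ifP => _; last by rewrite mul0rn.
    by rewrite addn1 -[LHS]mulr_natr -mulrA factS natrM invfM
      [X in _ * X]mulrAC mulVf ?mul1r ?pnatr_eq0.
  rewrite -(IH (fun c l => w c (l + (d == c))%N) (fun c => m c - (c == d))%N); last first.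
    by move=> c; rewrite ltn_subRL; case: (c == d); rewrite ?add1n // ltnW.
  over.
rewrite pair_big /=.
rewrite (reindex (fun p : D * {ffun 'I_n -> D} =>
   [ffun i => oapp p.2 p.1 (unlift ord0 i)])) /=; last first.
  exists (fun f => (f ord0, [ffun i => f (lift ord0 i)])) => [[d f]|f] _ /=.
    by rewrite ffunE unlift_none; congr pair; apply/ffunP => i; rewrite !ffunE liftK.
  by apply/ffunP => i; rewrite ffunE; case: unliftP => [j|] -> /=; rewrite ?ffunE.
by apply: eq_bigr => -[d f] _; apply: eq_bigr => c _; rewrite card_fiber_ord_recl addnC.
Qed.

(** * The multinomial theorem *)

Lemma coef_prod_poly (R : comNzRingType) (D : finType) n (c : D -> nat -> R) :
  (\prod_d \poly_(l < n.+1) c d l)`_n =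
  \sum_(g : {ffun D -> 'I_n.+1} | (\sum_d g d)%N == n) \prod_d c d (g d).
Proof.
under eq_bigr => d _ do rewrite poly_def.
rewrite bigA_distr_bigA /= coef_sum [RHS]big_mkcond; apply: eq_bigr => g _.
rewrite scaler_prod coefZ prodrXr coefXn eq_sym.
by case: eqP => _; rewrite ?mulr1 ?mulr0.
Qed.

(** With the indicator of [l == g d] as weight, [sum_ffun_fibers] counts exactly these maps, and
    only the choice of exponents [g] survives in the coefficient of X^n. *)
Lemma card_ffun_fibers (R : numFieldType) (D : finType) n
    (g : {ffun D -> 'I_n.+1}) : (\sum_d g d)%N = n ->
  #|[set f : {ffun 'I_n -> D} | [forall d, #|f @^-1: [set d]| == g d]]|%:R =
  n`!%:R / \prod_d (g d)`!%:R :> R.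
Proof.
move=> gn; pose w d l : R := (l == g d :> nat)%:R.
have wE (h : D -> nat) : \prod_d w d (h d) = [forall d, h d == g d]%:R.
  case: (boolP [forall d, _]) => [/forallP H|].
    by rewrite big1 // => d _; rewrite /w H.
  rewrite negb_forall => /existsP[d /negPf hd].
  by rewrite (bigD1 d) //= /w hd mul0r.
transitivity (\sum_(f : {ffun 'I_n -> D}) \prod_d w d #|f @^-1: [set d]|).
  under [RHS]eq_bigr => f _ do rewrite (wE (fun d => #|f @^-1: [set d]|)).
  by rewrite -natr_sum -big_mkcond sum1dep_card.
rewrite (sum_ffun_fibers R D n w (fun=> n.+1)) //; congr (_ * _).
rewrite coef_prod_poly (bigD1 g) ?gn //= [X in _ + X]big1 => [|h /andP[_ hg]].
  rewrite addr0 big_split /= (wE (fun d => g d)).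
  have -> : [forall d, g d == g d :> nat] by apply/forallP.
  by rewrite mul1r prodfV.
rewrite big_split /= (wE (fun d => h d)); case: forallP => [H|]; last by rewrite mul0r.
by case/eqP: hg; apply/ffunP => d; apply/val_inj/eqP/H.
Qed.
(** Expand the power into words of length n over [D], commute the letters, and group the words by
    fiber sizes, which [card_ffun_fibers] counts. The scalar field gives a meaning to the quotient
    of factorials. *)
Lemma multinomial (R : numFieldType) (A : comAlgType R) (D : finType) n (c : D -> A) :
  (\sum_d c d) ^+ n =
  \sum_(g : {ffun D -> 'I_n.+1} | (\sum_d g d)%N == n)
     (n`!%:R / \prod_d (g d)`!%:R) *: \prod_d c d ^+ g d.
Proof.
rewrite -[n in LHS](card_ord n) -prodr_const bigA_distr_bigA /=.
transitivity (\sum_(f : {ffun 'I_n -> D}) \prod_d c d ^+ #|f @^-1: [set d]|).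
  apply: eq_bigr => f _; rewrite (partition_big f xpredT) //=.
  apply: eq_bigr => d _; rewrite -prodr_const.
  apply: eq_big => [i|i /eqP -> //]; by rewrite !inE.
have le_fib (f : {ffun 'I_n -> D}) d : (#|f @^-1: [set d]| < n.+1)%N.
  by rewrite ltnS -[X in (_ <= X)%N](card_ord n) max_card.
pose fib f : {ffun D -> 'I_n.+1} := [ffun d => Ordinal (le_fib f d)].
have fibS f : (\sum_d fib f d)%N == n.
  rewrite -[X in _ == X](card_ord n) -sum1_card (partition_big f xpredT) //=.
  apply/eqP/eq_bigr => d _; rewrite ffunE /= -sum1_card.
  by apply: eq_bigl => i; rewrite !inE.
rewrite (partition_big fib (fun g => (\sum_d g d)%N == n)) //=.
apply: eq_bigr => g /eqP gn; rewrite -card_ffun_fibers // scaler_nat -sumr_const.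
apply: eq_big => [f|f /eqP <-]; last by apply: eq_bigr => d _; rewrite ffunE.
rewrite inE; apply/eqP/forallP => [<- d|H]; first by rewrite ffunE.
by apply/ffunP => d; apply: val_inj; rewrite ffunE /=; apply/eqP.
Qed.

Lemma exp_poly (R : numFieldType) m k (c : nat -> R) :
  (\poly_(i < m) c i) ^+ k =
  \sum_(g : {ffun 'I_m -> 'I_k.+1} | (\sum_i g i)%N == k)
     (k`!%:R / (\prod_(i < m) (g i)`!%:R) * \prod_(i < m) c i ^+ g i) *: 'X^(\sum_(i < m) i * g i).
Proof.
rewrite poly_def multinomial; apply: eq_bigr => g _.
under [X in _ *: X = _]eq_bigr => i _ do rewrite exprZn -exprM.
by rewrite scaler_prod scalerA prodrXr.
Qed.

(** * Partitions as kernels of labellings *)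

Lemma pblock_preim_partition (T : finType) (L : eqType) (F : T -> L) (x y : T) :
  (finset.pblock (preim_partition F [set: T]) x ==
   finset.pblock (preim_partition F [set: T]) y) = (F x == F y).
Proof.
have := preim_partitionP F [set: T].
set P := preim_partition _ _ => PP.
rewrite eq_pblock; last 2 first.
- by case/and3P: PP.
- by rewrite (cover_partition PP) inE.
rewrite pblock_equivalence_partition ?inE // => u v w _ _ _ /=.
by split=> // /eqP ->.
Qed.

Lemma eq_preim_partition (T : finType) (L M : eqType) (F : T -> L) (G : T -> M) :
  (forall x y, (F x == F y) = (G x == G y)) ->
  preim_partition F [set: T] = preim_partition G [set: T].
Proof.
by move=> FG; apply: eq_imset => x; apply/setP => y; rewrite !inE /= FG.
Qed.

(** A labelling with kernel [P] factors through the block map as an injective labelling of the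
    blocks, and every such injection arises once. *)
Lemma card_preim_partition (T L : finType) (P : {set {set T}}) :
  finset.partition P [set: T] ->
  #|[set F : {ffun T -> L} | preim_partition F [set: T] == P]| = #|L| ^_ #|P|.
Proof.
move=> PT; have pbP x : finset.pblock P x \in P.
  by rewrite pblock_mem // (cover_partition PT) inE.
pose D : finType := {B : {set T} | B \in P}.
pose pb x : D := Sub (finset.pblock P x) (pbP x).
have Dn0 (B : D) : exists x, x \in sval B.
  by case/and3P: PT => _ _ P0; apply/set0Pn; apply: contraNneq P0 => <-; apply: valP.
(* The label of a block is read off at a chosen point of it. *)
pose rep B : T := xchoose (Dn0 B).
have repK B : pb (rep B) = B.
  apply: val_inj; apply: def_pblock; rewrite ?(valP B) //; last exact: xchooseP.
  by case/and3P: PT.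
have cD : #|D| = #|P| by rewrite card_sig.
rewrite -cD -card_inj_ffuns.
have inj : injective (fun h : {ffun D -> L} => [ffun x => h (pb x)]).
  move=> h h' /ffunP hh; apply/ffunP => B.
  by have := hh (rep B); rewrite !ffunE repK.
rewrite -(card_imset _ inj); apply: eq_card => F; rewrite !inE.
apply/eqP/imsetP => [FP|[h]].
  have Fpb x y : (F x == F y) = (finset.pblock P x == finset.pblock P y).
    by rewrite -FP pblock_preim_partition.
  exists [ffun B => F (rep B)].
    rewrite inE; apply/injectiveP => B C; rewrite !ffunE => /eqP.
    by rewrite Fpb => /eqP BC; rewrite -(repK B) -(repK C); apply: val_inj.
  apply/ffunP => x; rewrite !ffunE; apply/eqP; rewrite Fpb.
  by rewrite -[finset.pblock P x]/(val (pb x)) -[X in val X]repK.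
rewrite inE => /injectiveP hinj ->.
rewrite -[RHS](preim_partition_pblock PT); apply: eq_preim_partition => x y.
by rewrite !ffunE (inj_eq hinj).
Qed.

Lemma preim_partition_fibers (T L : finType) (F : T -> L) :
  preim_partition F [set: T] = [set F @^-1: [set y] | y in codom F].
Proof.
apply/setP => B; apply/imsetP/imsetP => [[x _ ->]|[y /codomP[x ->] ->]].
  exists (F x); first exact: codom_f.
  by apply/setP => z; rewrite !inE eq_sym.
by exists x => //; apply/setP => z; rewrite !inE eq_sym.
Qed.

Lemma fiber_inj (T L : finType) (F : T -> L) :
  {in codom F &, injective (fun y => F @^-1: [set y])}.
Proof.
move=> y z /codomP[x ->] _ /= Fyz.
have : x \in F @^-1: [set z] by rewrite -Fyz !inE.
by rewrite !inE => /eqP.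
Qed.

Lemma codom_full (T L : finType) (F : T -> L) (y : L) :
  #|codom F| = #|L| -> y \in codom F.
Proof.
move=> FL; have /(subset_cardP FL) -> // : codom F \subset L.
exact/fintype.subsetP.
Qed.

(** * Bell polynomials as sums over numbered partitions *)

Lemma first_elts_lshift (r n : nat) (i : 'I_r) : lshift n i \in first_elts r (r + n).
Proof. by rewrite inE /=. Qed.

Definition block_weight {R : Type} (r N : nat) (a b : nat -> R) (B : {set 'I_N}) : R :=
  if B :&: first_elts r N == finset.set0 then a #|B| else b #|B|.
Arguments block_weight {R} r {N} a b B.

(** Group the labellings by kernel: a partition into K blocks is the kernel of K ^_ K = K! of them.
    The condition on [codom F] says that all K labels occur, so the product over blocks is a product
    over labels. *)
Lemma fact_rBell (R : comPzRingType) (r n K : nat) (a b : nat -> R) :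
  K`!%:R * rBell r (r + n) K a b =
  \sum_(F : {ffun 'I_(r + n) -> 'I_K} |
         injectiveb (fun i : 'I_r => F (lshift n i)) && (#|codom F| == K))
     \prod_j block_weight r a b (F @^-1: [set j]).
Proof.
have rP (F : {ffun 'I_(r + n) -> 'I_K}) :
    r_partition r K (preim_partition F [set: 'I_(r + n)]) =
    injectiveb (fun i : 'I_r => F (lshift n i)) && (#|codom F| == K).
  rewrite /r_partition leq_addr preim_partitionP /= andbC; congr andb; last first.
    by rewrite preim_partition_fibers (card_in_imset (@fiber_inj _ _ F)).
  apply/idP/injectiveP => [/forall_inP H i j /eqP|H].
    apply: contraTeq => ij; rewrite -pblock_preim_partition.
    have /H/forall_inP/(_ (lshift n j)) := first_elts_lshift r n i.
    by rewrite first_elts_lshift => /(_ isT)/implyP; apply; rewrite (inj_eq (@lshift_inj _ _)).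
  apply/forall_inP => i; rewrite inE => ir; apply/forall_inP => j; rewrite inE => jr.
  apply/implyP; apply: contraNneq => /eqP; rewrite pblock_preim_partition.
  have -> : i = lshift n (Ordinal ir) by apply: val_inj.
  have -> : j = lshift n (Ordinal jr) by apply: val_inj.
  by move=> /eqP /H ->.
transitivity (\sum_(P : {set {set 'I_(r + n)}} | r_partition r K P)
    K`!%:R * \prod_(B in P) block_weight r a b B).
  rewrite mulr_sumr; apply: eq_bigr => P _; congr (_ * _).
  rewrite [RHS](bigID (fun B => B :&: first_elts r (r + n) == finset.set0)) /=.
  by congr (_ * _); apply: eq_bigr => B /andP[_]; rewrite /block_weight; case: ifP.
transitivity (\sum_(F : {ffun 'I_(r + n) -> 'I_K} |
    r_partition r K (preim_partition F [set: 'I_(r + n)]))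
     \prod_(B in preim_partition F [set: 'I_(r + n)]) block_weight r a b B).
  rewrite (partition_big (fun F : {ffun 'I_(r + n) -> 'I_K} =>
    preim_partition F [set: 'I_(r + n)]) (r_partition r K)) //=.
  apply: eq_bigr => P rPP.
  rewrite [RHS](eq_bigr (fun=> \prod_(B in P) block_weight r a b B)); last first.
    by move=> F /andP[_ /eqP ->].
  rewrite [RHS](eq_bigl (mem [set F : {ffun 'I_(r + n) -> 'I_K} |
      preim_partition F [set: 'I_(r + n)] == P])); last first.
    by move=> F; rewrite !inE andbC; case: eqP => // ->; rewrite rPP.
  case/and4P: (rPP) => _ PT /eqP PK _.
  by rewrite sumr_const card_preim_partition // card_ord PK ffactnn mulr_natl.
apply: eq_big => // F; rewrite rP => /andP[_ /eqP FK].
rewrite preim_partition_fibers big_imset /=; last exact: fiber_inj.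
by apply: eq_bigl => j; rewrite codom_full // card_ord.
Qed.

(** Surjectivity becomes a weight: a label missed by both [e] and [g] carries the factor 0.
    Injectivity of [e] makes the fiber of [F] over a label in [codom e] just one point larger than
    that of [g]. *)
Lemma sum_labelled_ffun (R : comPzRingType) (r n K : nat) (a b : nat -> R) :
  \sum_(F : {ffun 'I_(r + n) -> 'I_K} |
         injectiveb (fun i : 'I_r => F (lshift n i)) && (#|codom F| == K))
     \prod_j block_weight r a b (F @^-1: [set j]) =
  \sum_(e : {ffun 'I_r -> 'I_K} | injectiveb e)
    \sum_(g : {ffun 'I_n -> 'I_K})
      \prod_j (if j \in codom e then b #|g @^-1: [set j]|.+1
               else if #|g @^-1: [set j]| == 0%N then 0 else a #|g @^-1: [set j]|).
Proof.
rewrite pair_big_dep /=.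
pose h (p : {ffun 'I_r -> 'I_K} * {ffun 'I_n -> 'I_K}) : {ffun 'I_(r + n) -> 'I_K} :=
  [ffun i : 'I_(r + n) => match fintype.split i with inl x => p.1 x | inr y => p.2 y end].
have hl p (i : 'I_r) : h p (lshift n i) = p.1 i by rewrite ffunE (unsplitK (inl i)).
have hr p (i : 'I_n) : h p (rshift r i) = p.2 i by rewrite ffunE (unsplitK (inr i)).
rewrite (reindex h) /=; last first.
  exists (fun F : {ffun 'I_(r + n) -> 'I_K} =>
    ([ffun i => F (lshift n i)], [ffun i => F (rshift r i)])).
    by move=> [e g] _; congr pair; apply/ffunP => i; rewrite ffunE ?hl ?hr.
  move=> F _; apply/ffunP => i; rewrite -(fintype.splitK i).
  by case: (fintype.split i) => j; rewrite ?hl ?hr ffunE.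
rewrite [LHS]big_mkcond [RHS]big_mkcond /=; apply: eq_bigr => -[e g] _.
have -> : injectiveb (fun i : 'I_r => h (e, g) (lshift n i)) = injectiveb e.
  by apply/injectiveP/injectiveP => H i j; [have := @H i j|have := @H i j]; rewrite !hl.
have [/injectiveP einj|] /= := boolP (injectiveb e); last by [].
have fib j : #|h (e, g) @^-1: [set j]| = ((j \in codom e) + #|g @^-1: [set j]|)%N.
  rewrite -!sum1_card !(big_mkcond (fun i => i \in _)) big_split_ord /=; congr addn.
    have [/codomP[i ->]|jn] := boolP (j \in codom e).
      rewrite (bigD1 i) //= !inE hl eqxx big1 // => i' /negPf ii'.
      by rewrite !inE hl /= (inj_eq einj) ii'.
    by rewrite big1 // => i _; rewrite !inE hl /=; case: eqP jn => // <-; rewrite codom_f.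
  by apply: eq_bigr => i _; rewrite !inE hr.
have meet j : (h (e, g) @^-1: [set j] :&: first_elts r (r + n) == finset.set0) =
    (j \notin codom e).
  apply/idP/idP => [/eqP H|jn].
    apply/codomP => -[i ji]; have : lshift n i \in finset.set0.
      by rewrite -H inE first_elts_lshift !inE hl ji /= eqxx.
    by rewrite inE.
  apply/eqP/setP => i; rewrite !inE; apply/negbTE; apply: contra jn => /andP[/eqP <- ir].
  have -> : i = lshift n (Ordinal ir) by apply: val_inj.
  by rewrite hl codom_f.
(* In the surjective case a label outside [codom e] is hit by [g], so its weight is not the default
   0. *)
case: ifPn => [/eqP cK|cK].
  apply: eq_bigr => j _; rewrite /block_weight meet fib.
  case: (boolP (j \in codom e)) => //= jn; rewrite add0n; case: eqP => // g0.
  have : j \in codom (h (e, g)) by rewrite codom_full // card_ord.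
  case/codomP => i ij; have : (0 < #|h (e, g) @^-1: [set j]|)%N.
    by apply/card_gt0P; exists i; rewrite !inE ij.
  by rewrite fib (negPf jn) g0.
(* Otherwise some label is missed altogether, and its factor 0 kills the product. *)
have [j jn] : exists j, j \notin codom (h (e, g)).
  apply/existsP; rewrite -negb_forall; apply: contra cK => /forallP H.
  by rewrite -[X in _ == X](card_ord K); apply/eqP/eq_card => j; rewrite H.
rewrite (bigD1 j) //=.
have /eqP : #|h (e, g) @^-1: [set j]| = 0%N.
  apply/eqP; rewrite cards_eq0; apply/eqP/setP => i; rewrite !inE; apply/negbTE.
  by apply: contra jn => /eqP <-; apply: codom_f.
by rewrite fib addn_eq0 eqb0 => /andP[/negPf -> ->]; rewrite mul0r.
Qed.

(** * The Bell polynomial as a coefficient *)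

(** The value 0 at 0 encodes that a block avoiding the r distinguished points is nonempty. *)
Definition avoid0 {R : nzRingType} (a : nat -> R) (l : nat) : R :=
  if l == 0%N then 0 else a l.

(** Truncation after degree n leaves the coefficients of products and powers up to X^n unchanged. *)
Definition egf {R : fieldType} (n : nat) (a : nat -> R) : {poly R} :=
  \poly_(l < n.+1) (a l / l`!%:R).

(** The inner sum is the same for all injections [e]; their number (k + r) ^_ r divides (k + r)!
    with quotient k!. *)
Lemma rBell_egf (R : numFieldType) (n k r : nat) (a b : nat -> R) :
  rBell r (n + r) (k + r) a b =
  n`!%:R / k`!%:R * (egf n (avoid0 a) ^+ k * egf n (fun l => b l.+1) ^+ r)`_n.
Proof.
have f0 m : m`!%:R != 0 :> R by rewrite pnatr_eq0 -lt0n fact_gt0.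
rewrite (addnC n); apply: (mulfI (f0 (k + r)%N)).
rewrite fact_rBell sum_labelled_ffun.
pose w (e : {ffun 'I_r -> 'I_(k + r)}) j :=
  if j \in codom e then fun l => b l.+1 else avoid0 a.
have inner (e : {ffun 'I_r -> 'I_(k + r)}) : injectiveb e ->
    \sum_(g : {ffun 'I_n -> 'I_(k + r)}) \prod_j w e j #|g @^-1: [set j]| =
    n`!%:R * (egf n (avoid0 a) ^+ k * egf n (fun l => b l.+1) ^+ r)`_n.
  move=> /injectiveP einj.
  rewrite (sum_ffun_fibers R _ n (w e) (fun=> n.+1)) //; congr (_ * (polyseq _)`_n).
  have ce : #|codom e| = r by rewrite card_codom // card_ord.
  (* The r labels in [codom e] contribute the factors B, the other k labels the factors A. *)
  rewrite (bigID (fun j => j \in codom e)) /= mulrC; congr (_ * _).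
    rewrite (eq_bigr (fun=> egf n (avoid0 a))) => [|j /negPf jn]; last by rewrite /w jn.
    rewrite prodr_const; congr (_ ^+ _).
    have := cardC (mem (codom e)); rewrite ce card_ord addnC => /addIn; apply: etrans.
    by apply: eq_card => j; rewrite !inE.
  rewrite (eq_bigr (fun=> egf n (fun l => b l.+1))) => [|j jn]; last by rewrite /w jn.
  by rewrite prodr_const ce.
rewrite (eq_bigr (fun=> n`!%:R *
    (egf n (avoid0 a) ^+ k * egf n (fun l => b l.+1) ^+ r)`_n)); last first.
  move=> e ei; rewrite -(inner e ei); apply: eq_bigr => g _; apply: eq_bigr => j _.
  by rewrite /w; case: ifP.
rewrite sumr_const.
have -> : #|[pred e : {ffun 'I_r -> 'I_(k + r)} | injectiveb e]| = (k + r) ^_ r.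
  have := card_inj_ffuns 'I_r 'I_(k + r); rewrite !card_ord => <-.
  by apply: eq_card => e; rewrite !inE.
rewrite -[LHS]mulr_natl -(ffact_fact (leq_addl k r)) addnK natrM.
by rewrite -!mulrA; congr (_ * _); rewrite [RHS]mulrCA mulVKf.
Qed.

(** * Finitely supported sequences as finite functions *)

Lemma big_fset_ord (R : Type) (idx : R) (op : Monoid.com_law idx) (m : nat)
    (s : {fset nat}) (F : nat -> R) :
  (forall i, i \in s -> (i < m)%N) -> (forall i, i \notin s -> F i = idx) ->
  \big[op/idx]_(i <- s) F i = \big[op/idx]_(i < m) F i.
Proof.
move=> sm sF; rewrite -(big_mkord xpredT F) [RHS](bigID (fun i => i \in s)) /=.
rewrite [X in op _ X]big1 // Monoid.mulm1 -[RHS]big_filter.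
apply: perm_big; apply: uniq_perm => [||i].
- exact: fset_uniq.
- by rewrite filter_uniq // iota_uniq.
- by rewrite mem_filter mem_index_iota andb_idr //; apply: sm.
Qed.

Definition fsfun_of_ffun {n m : nat} (g : {ffun 'I_n.+1 -> 'I_m.+1}) : finseq :=
  [fsfun i in [fset i in iota 0 n.+1]%fset => (g (inord i) : nat) | 0%N].

Lemma fsfun_of_ffunE n m (g : {ffun 'I_n.+1 -> 'I_m.+1}) i :
  fsfun_of_ffun g i = if (i < n.+1)%N then g (inord i) : nat else 0%N.
Proof. by rewrite fsfunE in_fset mem_iota. Qed.

Lemma fsfun_of_ffun_ord n m (g : {ffun 'I_n.+1 -> 'I_m.+1}) (i : 'I_n.+1) :
  fsfun_of_ffun g i = g i.
Proof. by rewrite fsfun_of_ffunE ltn_ord inord_val. Qed.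

Lemma finsupp_fsfun_of_ffun n m (g : {ffun 'I_n.+1 -> 'I_m.+1}) i :
  i \in finsupp (fsfun_of_ffun g) -> (i < n.+1)%N.
Proof. by rewrite mem_finsupp fsfun_of_ffunE; case: ifP. Qed.

(** An exponent 0 contributes the neutral element, as in 0! = 1 and x^0 = 1, so indices outside the
    support may be added. *)
Lemma big_finsupp_fsfun_of_ffun (R : Type) (idx : R) (op : Monoid.com_law idx)
    n m (g : {ffun 'I_n.+1 -> 'I_m.+1}) (F : nat -> nat -> R) :
  (forall i, F i 0%N = idx) ->
  \big[op/idx]_(i <- finsupp (fsfun_of_ffun g)) F i (fsfun_of_ffun g i) =
  \big[op/idx]_(i < n.+1) F i (g i).
Proof.
move=> F0; rewrite (big_fset_ord R idx op n.+1 _ (fun i => F i (fsfun_of_ffun g i))).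
- by apply: eq_bigr => i _; rewrite fsfun_of_ffun_ord.
- exact: finsupp_fsfun_of_ffun.
- by move=> i /fsfun_dflt ->.
Qed.

Lemma fsfun_of_ffun_inj n m : injective (@fsfun_of_ffun n m).
Proof.
move=> g h gh; apply/ffunP => i; apply: val_inj.
by rewrite /= -!fsfun_of_ffun_ord gh.
Qed.

Lemma fsfun_of_ffun_surj n (u : finseq) :
  (forall i, u i != 0%N -> (i <= n)%N) ->
  exists g : {ffun 'I_n.+1 -> 'I_(\sum_(i <- finsupp u) u i)%N.+1}, fsfun_of_ffun g = u.
Proof.
move=> un; exists [ffun i : 'I_n.+1 => inord (u i)].
apply/fsfunP => i; rewrite fsfun_of_ffunE; case: ltnP => ni; last first.
  by apply/eqP; rewrite eq_sym; apply: contraTT ni => /un; rewrite -ltnNge.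
rewrite ffunE !inordK // ltnS; case: (finsuppP u i) => // iu.
by rewrite (big_rem i) //= leq_addr.
Qed.

(* [Lambda] on exponent sequences indexed by 0, ..., n: no larger index can
   carry a nonzero exponent. *)
Definition admissible (n k r : nat)
    (p : {ffun 'I_n.+1 -> 'I_k.+1} * {ffun 'I_n.+1 -> 'I_r.+1}) : bool :=
  [&& p.1 ord0 == 0%N :> nat, (\sum_i p.1 i == k)%N, (\sum_i p.2 i == r)%N &
      (\sum_(i < n.+1) i * (p.1 i + p.2 i) == n)%N].

(** Turns the sum over [Lambda] into one over the index type that [exp_poly] produces. *)
Lemma set_bij_Lambda (n k r : nat) :
  set_bij [set` [pred p | admissible n k r p]] (Lambda n k r)
    (fun p => (fsfun_of_ffun p.1, fsfun_of_ffun p.2)).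
Proof.
have sums (p : {ffun 'I_n.+1 -> 'I_k.+1} * {ffun 'I_n.+1 -> 'I_r.+1}) :
    Lambda n k r (fsfun_of_ffun p.1, fsfun_of_ffun p.2) <-> admissible n k r p.
  rewrite /Lambda /admissible /=.
  rewrite (big_finsupp_fsfun_of_ffun _ _ _ _ _ p.1 (fun _ l => l)) //.
  rewrite (big_finsupp_fsfun_of_ffun _ _ _ _ _ p.2 (fun _ l => l)) //.
  rewrite (big_fset_ord _ _ _ n.+1 _
    (fun i => i * (fsfun_of_ffun p.1 i + fsfun_of_ffun p.2 i))%N); last 2 first.
  - by move=> i; rewrite in_fsetU => /orP[]; apply: finsupp_fsfun_of_ffun.
  - move=> i; rewrite in_fsetU negb_or => /andP[/fsfun_dflt -> /fsfun_dflt ->].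
    by rewrite muln0.
  rewrite (fsfun_of_ffun_ord _ _ p.1 ord0).
  have -> : (\sum_(i < n.+1) i * (fsfun_of_ffun p.1 i + fsfun_of_ffun p.2 i) =
             \sum_(i < n.+1) i * (p.1 i + p.2 i))%N.
    by apply: eq_bigr => i _; rewrite !fsfun_of_ffun_ord.
  split=> [[-> -> -> ->]|/and4P[/eqP -> /eqP -> /eqP -> /eqP ->]//].
  by rewrite !eqxx.
split.
- by move=> p /= /sums.
- by move=> [g h] [g' h'] _ _ [/fsfun_of_ffun_inj -> /fsfun_of_ffun_inj ->].
move=> [u v] uvL; have [_ /= uk vr uvn] := uvL.
(* A nonzero exponent at [i] contributes at least [i] to the total weight n. *)
have bnd i : (u i != 0%N) || (v i != 0%N) -> (i <= n)%N.
  move=> uv; have : (i * (u i + v i) <= n)%N.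
    rewrite -uvn (big_rem i) ?leq_addr //=.
    by rewrite in_fsetU !mem_finsupp.
  by apply: leq_trans; rewrite leq_pmulr // addn_gt0 !lt0n.
have [g gu] : exists g : {ffun 'I_n.+1 -> 'I_k.+1}, fsfun_of_ffun g = u.
  by rewrite -uk; apply: fsfun_of_ffun_surj => i ui; apply: bnd; rewrite ui.
have [h hv] : exists h : {ffun 'I_n.+1 -> 'I_r.+1}, fsfun_of_ffun h = v.
  by rewrite -vr; apply: fsfun_of_ffun_surj => i vi; apply: bnd; rewrite vi orbT.
by exists (g, h); rewrite /= ?gu ?hv //; apply/sums; rewrite /= gu hv.
Qed.

(** * Expansion of the coefficient *)

Theorem theorem3 (R : realType) (a b : nat -> R) (n k r : nat) :
  rBell r (n + r) (k + r) a b =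
  \sum_(x \in Lambda n k r)
     (n`!%:R / (\prod_(i <- finsupp x.1) (x.1 i)`!%:R)
        * \prod_(i <- finsupp x.1) (a i / i`!%:R) ^+ x.1 i)
     * (r`!%:R / (\prod_(i <- finsupp x.2) (x.2 i)`!%:R)
        * \prod_(i <- finsupp x.2) (b i.+1 / i`!%:R) ^+ x.2 i).
Proof.
have f0 m : m`!%:R != 0 :> R by rewrite pnatr_eq0 -lt0n fact_gt0.
rewrite (reindex_fsbig _ _ _ _ (set_bij_Lambda n k r)) -(bigfs _ (index_enum_uniq _)); last first.
  by move=> p _; rewrite mem_index_enum.
rewrite rBell_egf /egf !exp_poly mulr_suml coef_sum mulr_sumr.
under [LHS]eq_bigr => g _ do rewrite mulr_sumr coef_sum mulr_sumr.
rewrite pair_big /= [LHS]big_mkcond [RHS]big_mkcond; apply: eq_bigr => -[g h] _ /=.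
rewrite !(big_finsupp_fsfun_of_ffun _ _ _ _ _ _ (fun _ l => l`!%:R)) //.
rewrite (big_finsupp_fsfun_of_ffun _ _ _ _ _ g (fun i l => (a i / i`!%:R) ^+ l)) //.
rewrite (big_finsupp_fsfun_of_ffun _ _ _ _ _ h (fun i l => (b i.+1 / i`!%:R) ^+ l)) //.
rewrite /admissible /=.
rewrite -scalerAl -scalerAr scalerA -exprD coefZ coefXn.
have -> : (\sum_(i < n.+1) i * g i + \sum_(i < n.+1) i * h i =
           \sum_(i < n.+1) i * (g i + h i))%N.
  by rewrite -big_split; apply: eq_bigr => i _; rewrite mulnDr.
(* The conditions of [admissible] are matched one by one: the degree condition comes from the
   coefficient of X^n, the sums k and r from the two multinomial expansions. *)
rewrite (eq_sym n); case: (_ == n)%N; rewrite ?andbF ?mulr0 ?if_same // andbT mulr1.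
case: (_ == k)%N; rewrite ?andbF // andTb.
case: (_ == r)%N; rewrite ?andbF // andbT.
(* The multinomial expansion allows g 0 > 0, but A has constant term 0, so such terms vanish. *)
case: eqP => [g0|/eqP g0]; last first.
  have -> : \prod_(i < n.+1) (avoid0 a i / i`!%:R) ^+ g i = 0 :> R.
    by rewrite big_ord_recl /= mul0r expr0n (negPf g0) mul0r.
  by rewrite !(mul0r, mulr0).
have -> : \prod_(i < n.+1) (avoid0 a i / i`!%:R) ^+ g i =
          \prod_(i < n.+1) (a i / i`!%:R) ^+ g i.
  (* The two sequences can differ only at index 0, where the exponent is 0 and both powers are 1. *)
  apply: eq_bigr => i _; rewrite /avoid0; case: eqP => // i0.
  by have -> : i = ord0; [apply: val_inj | rewrite g0 !expr0].
(* The k! of the multinomial coefficient cancels the prefactor 1/k!. *)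
by rewrite !mulrA; congr (_ * _ * _ * _); rewrite mulrVK ?unitfE.
Qed.
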